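(* Let $k \geq 2$ be an even integer. Let $q$ be a prime power such that $q \equiv k+1 \pmod{2k}$. Then $$\mathcal{K}_3(G_k(q)) = \frac{q(q-1)}{k^3} \, ( \mathbb{R}_k(q) + q -2k+1),$$ where $$\mathbb{R}_k(q) := \sum_{\substack{s,t=1 \\ s+t \not\equiv 0 \, (k)}}^{k-1} J(\chi_k^s, \chi_k^t).$$
   Context: $\mathbb{F}_q$ is the finite field with $q$ elements and $S_k \subset \mathbb{F}_q^*$ is the subgroup of nonzero $k$-th powers (of order $\frac{q-1}{k}$). The $k$-th power Paley digraph $G_k(q)$ has vertex set $\mathbb{F}_q$, and $a \to b$ is an edge if and only if $b-a \in S_k$ (the condition on $q$ gives $-1 \notin S_k$, so there is at most one edge between any two vertices). For a digraph $G$, $\mathcal{K}_m(G)$ is the number of transitive subtournaments of order $m$ contained in $G$; a tournament of order $m$ is transitive if its vertices can be listed $a_1,\dots,a_m$ with $a_i \to a_j$ for all $i<j$. $\chi_k$ is a fixed (complex-valued) multiplicative character of $\mathbb{F}_q^*$ of order $k$. Multiplicative characters $\chi$ (including the trivial one) are extended to $\mathbb{F}_q$ by $\chi(0):=0$, and for characters $A,B$ the Jacobi sum is $J(A,B):=\sum_{a \in \mathbb{F}_q} A(a)B(1-a)$. *)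

(* Defs.v *)
From mathcomp Require Import all_boot all_order all_algebra.
From mathcomp Require Import all_field.
From mathcomp Require Import complex reals.

Set Implicit Arguments.
Unset Strict Implicit.
Unset Printing Implicit Defensive.

Import Order.TTheory GRing.Theory Num.Theory.
Local Open Scope ring_scope.

Section Digraphs.

Variable T : finType.

(* A pair (A, E) encodes the finite digraph with vertex set A and set of
   directed edges E. *)
Definition is_tournament (A : {set T}) (E : {set T * T}) : bool :=
  (E \subset setX A A) &&
  [forall x in A, forall y in A,
     if x == y then (x, y) \notin E
     else ((x, y) \in E) (+) ((y, x) \in E)].

Definition is_transitive (A : {set T}) (E : {set T * T}) : bool :=
  [exists s : #|A|.-tuple T,
     [&& uniq s, A == [set x in s] & pairwise (fun x y => (x, y) \in E) s]].

(* Subtournaments are counted as subgraphs, so that the count is also the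
   right one for digraphs having edges in both directions between two
   vertices. *)
Definition transitive_subtournaments (m : nat) (G : rel T) :
    {set {set T} * {set T * T}} :=
  [set H : {set T} * {set T * T} |
     [&& H.2 \subset [set e | G e.1 e.2],
         is_tournament H.1 H.2,
         #|H.1| == m &
         is_transitive H.1 H.2]].

Definition num_transitive_subtournaments (m : nat) (G : rel T) : nat :=
  #|transitive_subtournaments m G|.

End Digraphs.

Section Paley.

Variable F : finFieldType.

Definition kth_powers (k : nat) : {set F} := [set x ^+ k | x : F & x != 0].

Definition paley_digraph (k : nat) : rel F :=
  fun a b => b - a \in kth_powers k.

End Paley.

Section Characters.

Variables (R : realType) (F : finFieldType).
Implicit Types chi A B : {unit F} -> R[i].

Definition is_mul_char chi : Prop :=
  chi 1%g = 1 /\ (forall u v, chi (u * v)%g = chi u * chi v).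

Definition char_exp chi (n : nat) : {unit F} -> R[i] := fun u => chi u ^+ n.

Definition has_char_order chi (k : nat) : Prop :=
  [/\ (0 < k)%N,
      (forall u, char_exp chi k u = 1) &
      (forall n, (0 < n < k)%N -> ~ (forall u, char_exp chi n u = 1))].

(* Extension by 0 to all of F; insub a is None exactly when a = 0. In
   particular the trivial character extends to a function vanishing at 0. *)
Definition extend0 chi (a : F) : R[i] := oapp chi 0 (insub a).

Definition jacobi_sum A B : R[i] :=
  \sum_(a : F) extend0 A a * extend0 B (1 - a).

Definition jacobi_total (k : nat) chi : R[i] :=
  \sum_(1 <= s < k) \sum_(1 <= t < k | (s + t != 0 %[mod k])%N)
    jacobi_sum (char_exp chi s) (char_exp chi t).

End Characters.

(* Main.v *)
Require Import Defs.
From mathcomp Require Import all_boot all_order all_algebra.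
From mathcomp Require Import all_fingroup all_solvable all_field.
From mathcomp Require Import complex reals ring.

Set Implicit Arguments.
Unset Strict Implicit.
Unset Printing Implicit Defensive.

Import Order.TTheory GRing.Theory Num.Theory.
Local Open Scope ring_scope.

(** Write S for the group of nonzero k-th powers.  A transitive tournament of
order three in an irreflexive digraph is the same thing as a triple (a, b, c)
with a -> b, b -> c and a -> c, since the order of the vertices can be read off
from the edges ([num_transitive_subtournaments3]).  In the Paley digraph put
v = c - a and b - a = v w: as S is a group, the three edge conditions say that
v, w and 1 - w lie in S, so there are q |S| N such triples, where N is the
number of w with both w and 1 - w in S ([card_paley_triples]).

Both cardinals come from one orthogonality relation: the sum of the
chi^s (a) over 0 <= s < k is k if a is in S and 0 otherwise
([sum_char_exp]), because the multiplicative group is cyclic and chi sends a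
generator to a primitive k-th root of unity.  Summing over a gives
k |S| = q - 1, and multiplying the relations at a and 1 - a and summing over a
gives k^2 N as the sum of J(chi^s, chi^t) over 0 <= s, t < k
([card_consecutive_kth_powers]).

In that double sum, J(chi^0, chi^0) = q - 2; the 2(k - 1) terms with exactly one
zero exponent are -1 each; the terms with s, t > 0 and k not dividing s + t
make up [jacobi_total]; and the remaining ones are
J(chi^s, chi^(k - s)) = - chi^s (-1).  The congruence on q makes (q - 1) / k odd,
hence chi(-1) = -1 ([char_exp_opp1]), and since k is even these last terms add
up to 1.  Thus k^2 N = jacobi_total + q - 2 k + 1. *)

(** * Transitive tournaments of order three *)

(** Ordered triples [(a, b, c)] with edges a -> b, b -> c and a -> c. *)
Definition transitive_triples (T : finType) (G : rel T) : {set T * T * T} :=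
  [set p | [&& G p.1.1 p.1.2, G p.1.2 p.2 & G p.1.1 p.2]].

(** The transitive tournament on a, b, c, as a pair of a vertex set and an edge
set. *)
Definition triple_digraph (T : finType) (p : T * T * T) :
    {set T} * {set T * T} :=
  let: (a, b, c) := p in
  ([set a; b; c], [set (a, b); (b, c); (a, c)]).

Lemma triple_digraph_inj (T : finType) (G : rel T) :
  irreflexive G -> {in transitive_triples G &, injective (@triple_digraph T)}.
Proof.
move=> irrG.
have neqG x y : G x y -> x != y.
  by apply: contraTneq => ->; rewrite irrG.
move=> [[a b] c] [[a' b'] c']; rewrite !inE /=.
move=> /and3P[/neqG ab /neqG bc /neqG ac] /and3P[/neqG ab' /neqG bc' /neqG ac'].
case=> _ /setP eqE.
move: (eqE (a, b)) (eqE (b, c)) (eqE (a, c)); rewrite !inE !xpair_eqE !eqxx /=.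
rewrite ?orbT => /esym e1 /esym e2 /esym e3.
(* Each edge of the first tournament is one of the three edges of the second;
   every assignment other than the identity makes two vertices equal. *)
case/orP: e1 => [/orP[]|] /andP[/eqP ? /eqP ?]; subst;
case/orP: e2 => [/orP[]|] /andP[/eqP ? /eqP ?]; subst;
case/orP: e3 => [/orP[]|] /andP[/eqP ? /eqP ?]; subst => //;
by rewrite ?eqxx in ab bc ac ab' bc' ac'.
Qed.

Lemma transitive_subtournaments3E (T : finType) (G : rel T) :
  irreflexive G ->
  transitive_subtournaments 3 G = @triple_digraph T @: transitive_triples G.
Proof.
move=> irrG.
have neqG x y : G x y -> x != y.
  by apply: contraTneq => ->; rewrite irrG.
apply/setP => -[A E]; rewrite inE /=; apply/idP/imsetP; last first.
  case=> -[[a b] c]; rewrite inE /= => /and3P[Gab Gbc Gac] [-> ->].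
  have [[ab bc] ac] := (neqG _ _ Gab, neqG _ _ Gbc, neqG _ _ Gac).
  have cardA : #|[set a; b; c]| = 3.
    by rewrite setUC cardsU1 !inE cards2 ab (eq_sym c) (eq_sym c b)
              (negPf bc) (negPf ac).
  apply/and4P; split.
  - by apply/subsetP => -[x y]; rewrite !inE !xpair_eqE;
      case/orP=> [/orP[]|] /andP[/eqP -> /eqP ->].
  - apply/andP; split.
      by apply/subsetP => -[x y]; rewrite !inE !xpair_eqE;
        case/orP=> [/orP[]|] /andP[/eqP -> /eqP ->]; rewrite !eqxx ?orbT.
    have [ba cb ca] : [/\ b != a, c != b & c != a].
      by split; rewrite eq_sym.
    by apply/forall_inP => x; rewrite !inE => /orP[/orP[]|] /eqP ->;
      apply/forall_inP => y; rewrite !inE => /orP[/orP[]|] /eqP ->;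
      rewrite !xpair_eqE ?eqxx ?(negPf ab) ?(negPf bc) ?(negPf ac)
        ?(negPf ba) ?(negPf cb) ?(negPf ca) ?eqxx ?andbF.
  - by rewrite cardA.
  - rewrite /is_transitive cardA; apply/existsP; exists [tuple a; b; c].
    apply/and3P; split.
    + by rewrite /= !inE negb_or ab ac bc.
    + by apply/eqP/setP => x; rewrite !inE orbA.
    + by rewrite /= !inE !eqxx !orbT.
case/and4P=> /subsetP subG /andP[/subsetP subA /forall_inP tourE] /eqP cardA.
case/existsP=> s /and3P[_ /eqP defA].
have {}defA x : (x \in A) = (x \in tval s) by rewrite [in LHS]defA inE.
have size_s : size (tval s) = 3 by rewrite size_tuple cardA.
case: (tval s) defA size_s => [|a [|b [|c []]]] //.
rewrite /= !andbT => defA _ /andP[/andP[Eab Eac] Ebc].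
have AE x : (x \in A) = [|| x == a, x == b | x == c] by rewrite defA !inE.
exists (a, b, c).
  rewrite inE /=; move: (subG _ Eab) (subG _ Ebc) (subG _ Eac).
  by rewrite !inE /= => -> -> ->.
congr pair; first by apply/setP=> x; rewrite AE !inE orbA.
(* The edge set contains (a, b), (b, c) and (a, c); as a tournament it has no
   edge in the opposite direction, so nothing else. *)
have asymE x y : (x, y) \in E -> (y, x) \notin E.
  move=> Exy; have := subA _ Exy; rewrite inE /= => /andP[Ax Ay].
  have /forall_inP/(_ y Ay) := tourE x Ax; rewrite Exy.
  by have := subG _ Exy; rewrite inE /= => /neqG/negPf -> /=.
have irrE x : (x, x) \notin E.
  by apply/negP => /subG; rewrite inE /= irrG.
apply/setP => -[x y]; rewrite !inE !xpair_eqE; apply/idP/idP; last first.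
  by case/orP=> [/orP[]|] /andP[/eqP -> /eqP ->].
move=> Exy; have := subA _ Exy; rewrite inE /= !AE.
by case/andP=> /or3P[] /eqP ex /or3P[] /eqP ey; move: Exy;
  rewrite ex ey ?eqxx ?orbT //= => Exy; move: (irrE x) (asymE _ _ Exy);
  rewrite ex ?Exy ?Eab ?Ebc ?Eac.
Qed.

Lemma num_transitive_subtournaments3 (T : finType) (G : rel T) :
  irreflexive G ->
  num_transitive_subtournaments 3 G = #|transitive_triples G|.
Proof.
move=> irrG; rewrite /num_transitive_subtournaments.
by rewrite transitive_subtournaments3E // card_in_imset //; exact: triple_digraph_inj.
Qed.

(** * Transitive triples of the Paley digraph *)

Section PaleyTriples.

Variables (F : finFieldType) (k : nat).
Local Notation S := (kth_powers F k).

(** The k-th powers [w] for which [1 - w] is again a k-th power (both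
nonzero). *)
Definition consecutive_kth_powers : {set F} := [set w in S | 1 - w \in S].

Lemma kth_powers_neq0 a : a \in S -> a != 0.
Proof. by case/imsetP=> x; rewrite inE => x0 ->; rewrite expf_neq0. Qed.

Lemma kth_powersMl a b : a \in S -> (a * b \in S) = (b \in S).
Proof.
case/imsetP=> x; rewrite inE => x0 ->; apply/imsetP/imsetP => -[y].
  rewrite inE => y0 e; exists (y / x); first by rewrite inE mulf_neq0 ?invr_eq0.
  by rewrite expr_div_n -e mulrC mulKf // expf_neq0.
rewrite inE => y0 ->; exists (x * y); first by rewrite inE mulf_neq0.
by rewrite exprMn.
Qed.

Lemma paley_digraph_irr : irreflexive (@paley_digraph F k).
Proof.
by move=> a; apply/negP; rewrite /paley_digraph subrr => /kth_powers_neq0/eqP.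
Qed.

Lemma card_paley_triples :
  #|transitive_triples (@paley_digraph F k)| =
  (#|F| * #|S| * #|consecutive_kth_powers|)%N.
Proof.
(* The triple (a, v, w) parametrizes a, b = a + v w, c = a + v, for which
   b - a = v w, c - b = v (1 - w) and c - a = v. *)
pose f (p : F * F * F) := let: (a, v, w) := p in (a, a + v * w, a + v).
pose D := setX (setX [set: F] S) consecutive_kth_powers.
have -> : transitive_triples (@paley_digraph F k) = f @: D.
  apply/setP => -[[a b] c]; rewrite inE /= /paley_digraph.
  apply/and3P/imsetP => [[Sba Scb Sca]|[[[a' v] w]]].
    have ca0 := kth_powers_neq0 Sca.
    exists (a, c - a, (b - a) / (c - a)).
      rewrite !inE /= Sca /= -(kth_powersMl _ Sca) -(kth_powersMl (1 - _) Sca).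
      rewrite mulrBr mulr1 mulrCA mulfV // mulr1 Sba /=.
      by rewrite opprB addrA subrK.
    by rewrite /f mulrCA mulfV // mulr1 !(addrC a) !subrK.
  rewrite !inE /= => /and3P[Sv Sw S1w] [-> -> ->].
  have e1 : a' + v * w - a' = v * w by ring.
  have e2 : a' + v - (a' + v * w) = v * (1 - w) by ring.
  have e3 : a' + v - a' = v by ring.
  by rewrite e1 e2 e3 !kth_powersMl.
rewrite card_in_imset ?cardsX ?cardsT //.
move=> [[a v] w] [[a' v'] w']; rewrite !inE /= => /and3P[Sv _ _] _ [<-].
by move=> /addrI + /addrI ev; rewrite -ev => /(mulfI (kth_powers_neq0 Sv)) ->.
Qed.

End PaleyTriples.

(** * Jacobi sums *)

Section JacobiSums.

Variables (R : realType) (F : finFieldType).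
Implicit Types A B : {unit F} -> R[i].

Lemma extend0_0 A : extend0 A 0 = 0.
Proof. by rewrite /extend0 insubF // unitr0. Qed.

Lemma extend0_val A (u : {unit F}) : extend0 A (val u) = A u.
Proof. by rewrite /extend0 valK. Qed.

(** Every nonzero element of a finite field is the value of a unit; this is
the case analysis matching the definition of [extend0]. *)
Lemma unit_valP (a : F) : a != 0 -> exists u : {unit F}, a = val u.
Proof. by rewrite -unitfE => Ua; exists (FinRing.Unit Ua). Qed.

Lemma extend0M A : is_mul_char A -> {morph extend0 A : a b / a * b}.
Proof.
case=> _ AM a b; have [->|/unit_valP[u ->]] := eqVneq a 0.
  by rewrite mul0r extend0_0 mul0r.
have [->|/unit_valP[v ->]] := eqVneq b 0.
  by rewrite mulr0 extend0_0 mulr0.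
by rewrite -FinRing.val_unitM !extend0_val AM.
Qed.

Lemma is_mul_char_exp A n : is_mul_char A -> is_mul_char (char_exp A n).
Proof.
case=> A1 AM; split=> [|u v]; rewrite /char_exp ?A1 ?expr1n // AM exprMn //.
Qed.

(** A nontrivial character sums to zero: multiplying the sum by [A u] permutes
its terms. *)
Lemma sum_mul_char A (u : {unit F}) :
  is_mul_char A -> A u != 1 -> \sum_(a : F) extend0 A a = 0.
Proof.
move=> charA Au1; apply/eqP; set s := \sum_a _.
have u0 : val u != 0 by rewrite -unitfE; exact: valP.
have e : A u * s = s.
  rewrite -extend0_val big_distrr /= [RHS](reindex_inj (mulfI u0)) /=.
  by apply: eq_bigr => a _; rewrite extend0M.
by rewrite -(mulIr_eq0 _ (mulIf (_ : 1 - A u != 0))) ?subr_eq0 1?eq_sym //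
  mulrBr mulr1 mulrC e subrr.
Qed.

Lemma extend0_triv A a : A =1 (fun=> 1) -> extend0 A a = (a != 0)%:R.
Proof.
move=> A1; have [->|/unit_valP[u ->]] := eqVneq a 0; first exact: extend0_0.
by rewrite extend0_val A1.
Qed.

Lemma jacobi_sumC A B : jacobi_sum A B = jacobi_sum B A.
Proof.
rewrite /jacobi_sum (reindex_inj (can_inj (subKr (1 : F)))) /=.
by apply: eq_bigr => a _; rewrite subKr mulrC.
Qed.

Lemma jacobi_triv_triv A B : A =1 (fun=> 1) -> B =1 (fun=> 1) ->
  jacobi_sum A B = #|F|%:R - 2%:R.
Proof.
move=> A1 B1; rewrite /jacobi_sum.
have e a : extend0 A a * extend0 B (1 - a) = 1 - (a == 0)%:R - (a == 1)%:R.
  rewrite !extend0_triv // subr_eq0 (eq_sym 1).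
  have [->|_] := eqVneq a 0; first by rewrite eq_sym oner_eq0 !subr0 subrr mul0r.
  by case: eqP => _; rewrite /= ?mulr0 ?mul1r !subr0 ?subrr.
have d c : \sum_(a : F) (a == c)%:R = 1 :> R[i].
  by rewrite (bigD1 c) //= eqxx big1 ?addr0 // => a /negPf ->.
by rewrite (eq_bigr _ (fun a _ => e a)) !sumrB !d sumr_const -addrA -opprD.
Qed.

Lemma jacobi_triv A B u :
  A =1 (fun=> 1) -> is_mul_char B -> B u != 1 -> jacobi_sum A B = -1.
Proof.
move=> A1 charB Bu1; rewrite /jacobi_sum.
have : \sum_a extend0 B (1 - a) = 0.
  by rewrite -[RHS](sum_mul_char charB Bu1) [RHS](reindex_inj (can_inj (subKr 1))).
rewrite [X in X = 0 -> _](bigD1 0) //= [X in _ -> X = _](bigD1 0) //=.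
rewrite extend0_0 mul0r add0r subr0.
have -> : extend0 B 1 = 1 by have := extend0_val B 1%g; rewrite /= charB.1.
move/eqP; rewrite addrC addr_eq0 => /eqP <-.
by apply: eq_bigr => a a0; rewrite extend0_triv // a0 mul1r.
Qed.

(** The Jacobi sum of a nontrivial character and its inverse: away from
[a = 1] the summand is [A (a / (1 - a))], and [a / (1 - a)] takes every value
but -1 exactly once. *)
Lemma jacobi_inv A B u :
  is_mul_char A -> is_mul_char B -> (forall v, A v * B v = 1) -> A u != 1 ->
  jacobi_sum A B = - extend0 A (-1).
Proof.
move=> charA charB AB Au1; rewrite /jacobi_sum (bigD1 1) //= subrr extend0_0.
rewrite mulr0 add0r.
have := sum_mul_char charA Au1; rewrite (bigD1 (-1)) //= => /eqP.
rewrite addrC addr_eq0 => /eqP <-.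
rewrite (reindex_onto (fun b : F => b / (1 + b)) (fun a => a / (1 - a))) /=; last first.
  move=> a a1; have ha : 1 - a != 0 by rewrite subr_eq0 eq_sym.
  by field; rewrite ha; rewrite (_ : 1 - a + a = 1) ?oner_neq0 //; ring.
have nz (b : F) : (1 + b != 0) = (b != -1) by rewrite addrC addr_eq0.
apply: eq_big => b.
  have [->|] := eqVneq b (-1).
    by rewrite subrr invr0 mulr0 mul0r [0 == -1]eq_sym oppr_eq0 oner_eq0 andbF.
  rewrite -nz => b1; apply/andP; split.
    rewrite -subr_eq0 (_ : _ - 1 = - (1 + b)^-1); last by field.
    by rewrite oppr_eq0 invr_eq0.
  by apply/eqP; field; rewrite b1; rewrite (_ : 1 + b - b = 1) ?oner_neq0 //; ring.
case/andP=> _; have [->|] := eqVneq b (-1).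
  by rewrite subrr invr0 mulr0 mul0r [0 == -1]eq_sym oppr_eq0 oner_eq0.
rewrite -nz => b1 _.
have -> : 1 - b / (1 + b) = (1 + b)^-1 by field.
rewrite extend0M // -mulrA.
have /unit_valP[v ->] : (1 + b)^-1 != 0 by rewrite invr_eq0.
by rewrite !extend0_val AB mulr1.
Qed.

End JacobiSums.

(** * Jacobi sums of powers of a character of order k *)

(** The sum starts at exponent 1, so it is the complete alternating sum minus
its first term. *)
Lemma sum_sign_even (R : numDomainType) n : ~~ odd n -> (0 < n)%N ->
  \sum_(1 <= s < n) (-1) ^+ s = -1 :> R.
Proof.
move=> evn n0; have /eqP := subrX1 (-1 : R) n.
rewrite -signr_odd (negPf evn) subrr eq_sym mulf_eq0.
rewrite -opprD oppr_eq0 (_ : 1 + 1 == 0 = false) ?(pnatr_eq0 _ 2) //=.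
by rewrite -(big_mkord xpredT) big_ltn //= expr0 addrC addr_eq0 => /eqP.
Qed.

Section CharacterOfOrder.

Variables (R : realType) (F : finFieldType) (k : nat) (chi : {unit F} -> R[i]).
Hypotheses (hchi : is_mul_char chi) (hord : has_char_order chi k).

Local Notation S := (kth_powers F k).
Local Notation J s t := (jacobi_sum (char_exp chi s) (char_exp chi t)).

Lemma char_order_gt0 : (0 < k)%N.
Proof. by case: hord. Qed.

Lemma is_mul_charX u n : chi (u ^+ n)%g = chi u ^+ n.
Proof.
case: hchi => chi1 chiM; elim: n => [|n IHn]; first by rewrite expg0 chi1.
by rewrite expgS chiM IHn exprS.
Qed.

(** On a generator the order of the value of [chi] is the order of [chi]. *)
Lemma primitive_generator_value (g : {unit F}) :
  (forall u, u \in <[g]>%g) -> k.-primitive_root (chi g).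
Proof.
case: hord => k0 chik minl gen.
have [m prim_m m_dvd] := prim_order_exists k0 (chik g).
have m0 := prim_order_gt0 prim_m.
have [<- //|neq] := eqVneq m k.
case: (minl m) => [|u].
  by rewrite m0 ltn_neqAle neq dvdn_leq.
have /cycleP[j ->] := gen u.
by rewrite /char_exp is_mul_charX exprAC (prim_expr_order prim_m) expr1n.
Qed.

Lemma unit_generator : exists g : {unit F}, forall u, u \in <[g]>%g.
Proof.
have /cyclicP[g eg] := field_unit_group_cyclic [group of [set: {unit F}]].
by exists g => u; rewrite -eg inE.
Qed.

(** The kernel of [chi] is the group of nonzero k-th powers. *)
Lemma char_eq1 (u : {unit F}) : (chi u == 1) = (val u \in S).
Proof.
apply/eqP/imsetP => [chiu|[x]].
  have [g gen] := unit_generator; have /cycleP[j ej] := gen u.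
  move/eqP: chiu; rewrite ej is_mul_charX.
  rewrite -(prim_order_dvd (primitive_generator_value gen)) => /dvdnP[i ->].
  exists (val (g ^+ i)%g); first by rewrite inE -unitfE; exact: valP.
  by rewrite expgM; exact: FinRing.val_unitX.
rewrite inE => /unit_valP[v ->]; rewrite -FinRing.val_unitX => /val_inj ->.
by rewrite is_mul_charX; case: hord => _ + _; apply.
Qed.

(** Orthogonality: the indicator of the k-th powers as an average of the powers
of [chi].  It holds at [a = 0] because all characters, including the trivial one,
are extended by 0. *)
Lemma sum_char_exp (a : F) :
  \sum_(0 <= s < k) extend0 (char_exp chi s) a = k%:R * (a \in S)%:R.
Proof.
have [->|/unit_valP[u ->]] := eqVneq a 0.
  rewrite big1 => [|s _]; last exact: extend0_0.
  by case: (boolP (_ \in _)) => [/kth_powers_neq0|_]; rewrite ?eqxx // mulr0.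
rewrite -char_eq1; under eq_bigr do rewrite extend0_val.
rewrite /char_exp big_mkord; case: eqVneq => [->|chiu].
  by under eq_bigr do rewrite expr1n; rewrite sumr_const card_ord mulr1.
rewrite mulr0; apply/eqP; have /eqP := subrX1 (chi u) k.
have -> : chi u ^+ k = 1 by case: hord => _ + _; apply.
by rewrite subrr eq_sym mulf_eq0 subr_eq0 (negPf chiu).
Qed.

Lemma char_exp_neq1 n : (0 < n < k)%N -> exists u, char_exp chi n u != 1.
Proof.
case: hord => _ _ /[apply] nT; apply/existsP; apply: contra_notT nT.
by move/existsPn => h u; apply/eqP/negbNE/h.
Qed.

Lemma char_exp0 : char_exp chi 0 =1 (fun=> 1).
Proof. by move=> u; rewrite /char_exp expr0. Qed.

Lemma card_kth_powers : k%:R * #|S|%:R = #|F|%:R - 1 :> R[i].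
Proof.
have -> : k%:R * #|S|%:R = \sum_(a : F) k%:R * (a \in S)%:R :> R[i].
  by rewrite -big_distrr -natr_sum -big_mkcond sum1_card.
under eq_bigr do rewrite -sum_char_exp.
rewrite exchange_big /= big_ltn ?char_order_gt0 //= [X in _ + X]big_nat_cond.
rewrite [X in _ + X]big1 => [|n]; last first.
  case/andP=> /char_exp_neq1[u un1] _.
  exact: sum_mul_char (is_mul_char_exp _ hchi) un1.
rewrite addr0; under eq_bigr do rewrite (extend0_triv _ char_exp0).
rewrite -natr_sum -big_mkcond sum1_card (cardC1 (0 : F)) -subn1 natrB //.
exact: ltnW (finNzRing_gt1 F).
Qed.

(** Summing over [a] the product of the orthogonality relations at [a] and
[1 - a]. *)
Lemma card_consecutive_kth_powers :
  k%:R ^+ 2 * #|consecutive_kth_powers F k|%:R =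
  \sum_(0 <= s < k) \sum_(0 <= t < k) J s t.
Proof.
under [RHS]eq_bigr do rewrite exchange_big /=.
rewrite exchange_big /=.
under [RHS]eq_bigr => a _.
  under eq_bigr do rewrite -big_distrr /= sum_char_exp.
  rewrite -big_distrl /= sum_char_exp.
  rewrite mulrACA -expr2 -natrM mulnb.
over.
rewrite -big_distrr -natr_sum -big_mkcond -sum1_card /=.
by under [in LHS]eq_bigl do rewrite inE.
Qed.

Lemma jacobi_sum_exp_compl s : (0 < s < k)%N ->
  J s (k - s) = - extend0 (char_exp chi s) (-1).
Proof.
move=> sk; have [u un1] := char_exp_neq1 sk.
apply: jacobi_inv un1; try exact: is_mul_char_exp.
move=> v; rewrite /char_exp -exprD subnKC; last by case/andP: sk => _ /ltnW.
by case: hord => _ + _; apply.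
Qed.

(** Separates the terms with a zero exponent, those counted by [jacobi_total],
and those with s + t = k. *)
Lemma sum_jacobi_exp :
  \sum_(0 <= s < k) \sum_(0 <= t < k) J s t =
  #|F|%:R - 2%:R - 2%:R * (k%:R - 1) + jacobi_total k chi
  - \sum_(1 <= s < k) extend0 (char_exp chi s) (-1).
Proof.
have k0 := char_order_gt0.
have row0 : \sum_(1 <= t < k) J 0 t = - (k%:R - 1).
  rewrite big_nat_cond (eq_bigr (fun=> -1)) => [|t]; last first.
    case/andP=> /char_exp_neq1[u un1] _.
    exact: jacobi_triv char_exp0 (is_mul_char_exp _ hchi) un1.
  by rewrite -big_nat_cond sumr_const_nat mulNrn natrB.
rewrite big_ltn // [X in X + _]big_ltn //.
rewrite (jacobi_triv_triv char_exp0 char_exp0) row0.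
under eq_bigr do rewrite big_ltn // jacobi_sumC.
rewrite big_split /= row0.
have -> : \sum_(1 <= s < k) \sum_(1 <= t < k) J s t =
    jacobi_total k chi - \sum_(1 <= s < k) extend0 (char_exp chi s) (-1).
  rewrite /jacobi_total -sumrB; apply: eq_big_nat => s /andP[s0 sk].
  rewrite (bigID (fun t => (s + t != 0 %[mod k])%N)) /=; congr (_ + _).
  rewrite -jacobi_sum_exp_compl ?s0 //.
  have kcs : (k - s)%N \in index_iota 1 k.
    by rewrite mem_index_iota subn_gt0 sk ltn_subrL s0.
  rewrite big_mkcond (bigD1_seq _ kcs (iota_uniq _ _)) /= subnKC 1?ltnW //.
  rewrite modnn mod0n eqxx /= big1_seq ?addr0 // => t /andP[tks].
  rewrite mem_index_iota => /andP[t0 tk]; case: ifPn => //; rewrite negbK.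
  case/dvdnP=> i est; case/eqP: tks.
  (* Since 0 < s + t < 2 k, the only multiple of k that s + t can be is k. *)
  have i1 : i = 1%N.
    have : (0 < i * k < 2 * k)%N.
      rewrite -est addn_gt0 s0 mul2n -addnn; exact: leq_add sk (ltnW tk).
    by rewrite muln_gt0 ltn_pmul2r // => /andP[/andP[]]; case: i {est} => [|[]].
  by rewrite -[X in (X - s)%N]mul1n -i1 -est addKn.
ring.
Qed.

(** If (q - 1) / k is odd and k is even, then chi(-1) = -1: for a generator g,
the element h = g^((q - 1) / 2) has h^2 = 1 but is not in the kernel of chi, so
h = -1 and, as chi(h)^2 = 1, chi(h) = -1. *)
Lemma char_exp_opp1 s : ~~ odd k -> (#|F| = k + 1 %[mod 2 * k])%N ->
  extend0 (char_exp chi s) (-1) = (-1) ^+ s.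
Proof.
move=> evk hq; have k0 := char_order_gt0.
have [g gen] := unit_generator; have prim := primitive_generator_value gen.
pose h := (g ^+ (#|F|.-1)./2)%g.
have [m em] : exists m, #|F|.-1 = (k * m.*2.+1)%N.
  have k2 : (1 < k)%N by case: (k) k0 evk => [|[]].
  exists (#|F| %/ (2 * k))%N.
  rewrite {1}(divn_eq #|F| (2 * k)) hq modn_small; last first.
    by rewrite mul2n -addnn ltn_add2l.
  by rewrite addnA addn1 /= mulnS addnC mulnA muln2 mulnC.
have chih : chi h != 1.
  rewrite /h is_mul_charX -(prim_order_dvd prim) em.
  (* With k = 2 j, half of q - 1 = 2 j (2 m + 1) is j (2 m + 1), which 2 j does
     not divide. *)
  move: k0; rewrite -(even_halfK evk) double_gt0 => j0.
  rewrite -doubleMl doubleK -muln2 dvdn_pmul2l // dvdn2 /=.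
  by rewrite odd_double.
have h2 : (h ^+ 2)%g = 1%g.
  rewrite /h -expgM muln2 even_halfK; last by rewrite em oddM negb_and evk.
  by rewrite -card_finField_unit expg_cardG ?inE.
have hN1 : val h = -1.
  have /eqP : val h ^+ 2 = 1 by rewrite -FinRing.val_unitX h2.
  rewrite sqrf_eq1 => /orP[/eqP h1|/eqP //]; case/eqP: chih.
  by case: hchi => <- _; congr chi; exact: val_inj.
rewrite -hN1 extend0_val /char_exp.
have /eqP : chi h ^+ 2 = 1 by rewrite -is_mul_charX h2; case: hchi.
by rewrite sqrf_eq1 (negPf chih) => /eqP ->.
Qed.

End CharacterOfOrder.

Theorem theorem2p6 (R : realType) (k q : nat) (F : finFieldType)
    (chi : {unit F} -> R[i])
    (hk2 : (2 <= k)%N) (hk_even : ~~ odd k)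
    (hF : #|F| = q)
    (hq : (q = k + 1 %[mod 2 * k])%N)
    (hchi : is_mul_char chi) (hord : has_char_order chi k) :
  (num_transitive_subtournaments 3 (@paley_digraph F k))%:R
  = q%:R * (q%:R - 1) / k%:R ^+ 3
    * (jacobi_total k chi + q%:R - 2%:R * k%:R + 1) :> R[i].
Proof.
subst q; have k0 : k%:R != 0 :> R[i] by rewrite pnatr_eq0 -lt0n ltnW.
rewrite num_transitive_subtournaments3; last exact: paley_digraph_irr.
rewrite card_paley_triples !natrM.
have eN := card_consecutive_kth_powers hchi hord.
have := sum_jacobi_exp hchi hord; rewrite -eN.
under eq_bigr => s _ do rewrite (char_exp_opp1 hchi hord s hk_even hq).
rewrite sum_sign_even //; last exact: ltnW.
have <- := card_kth_powers hchi hord => eN2.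
have -> : jacobi_total k chi + #|F|%:R - 2%:R * k%:R + 1 =
   k%:R ^+ 2 * #|consecutive_kth_powers F k|%:R by rewrite eN2; ring.
by field.
Qed.
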